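(* Let $p$ be a prime and let $G=D_{2p}$. Then $\mathcal{B}(G)$ is hypoenergetic, and it is not hyperenergetic, not L-hyperenergetic, not Q-hyperenergetic and not CN-hyperenergetic.
   Context: $D_{2m}=\langle a,b : a^m=b^2=1,\ bab=a^{-1}\rangle$ is the dihedral group of order $2m$ (for $m=2$ it is the group of order $4$ given by this presentation). For a finite group $G$, let $L(G)$ be the set of all subgroups of $G$. The subgroup generating bipartite graph $\mathcal{B}(G)$ is the simple bipartite graph with vertex set the disjoint union of $G\times G$ and $L(G)$, in which $(a,b)\in G\times G$ and $H\in L(G)$ are adjacent if and only if $H$ is the subgroup generated by $a$ and $b$ (and there are no other edges). For a finite simple graph $\Gamma$ with $n$ vertices $v_1,\dots,v_n$ and $m$ edges, let $A$ be its adjacency matrix, $D$ its diagonal degree matrix, and $CN(\Gamma)$ the common neighborhood matrix, whose $(i,j)$ entry for $i\neq j$ is the number of vertices other than $v_i,v_j$ adjacent to both $v_i$ and $v_j$, with zero diagonal. The energy $E(\Gamma)$ and the common neighborhood energy $E_{CN}(\Gamma)$ are the sums of absolute values of the eigenvalues (with multiplicity) of $A$ and $CN(\Gamma)$ respectively. The Laplacian energy is $LE(\Gamma)=\sum_{\lambda}|\lambda-\frac{2m}{n}|$ over the eigenvalues $\lambda$ of $D-A$, and the signless Laplacian energy is $LE^+(\Gamma)=\sum_{\mu}|\mu-\frac{2m}{n}|$ over the eigenvalues $\mu$ of $D+A$ (both counted with multiplicity). With $K_n$ the complete graph on $n=|V(\Gamma)|$ vertices, $\Gamma$ is called hypoenergetic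 if $E(\Gamma)<n$; hyperenergetic if $E(\Gamma)>E(K_n)$; L-hyperenergetic if $LE(\Gamma)>LE(K_n)$; Q-hyperenergetic if $LE^+(\Gamma)>LE^+(K_n)$; CN-hyperenergetic if $E_{CN}(\Gamma)>E_{CN}(K_n)$. Here $E(K_n)=LE(K_n)=LE^+(K_n)=2(n-1)$ and $E_{CN}(K_n)=2(n-1)(n-2)$. *)

(* Defs.v *)
From HB Require Import structures.
From mathcomp Require Import all_boot all_order all_algebra all_fingroup.

Set Implicit Arguments.
Unset Strict Implicit.
Unset Printing Implicit Defensive.

Import Order.TTheory GRing.Theory Num.Theory.

Record sgraph := SGraph {
  vertex :> finType;
  adj : rel vertex;
  adj_sym : symmetric adj;
  adj_irrefl : irreflexive adj
}.

Definition edges (g : sgraph) : {set {set g}} :=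
  [set [set u; v] | u in g, v in g & adj u v].

Definition complete_rel n : rel 'I_n := fun i j => i != j.

Lemma complete_sym n : symmetric (@complete_rel n).
Proof. by move=> i j; rewrite /complete_rel eq_sym. Qed.

Lemma complete_irrefl n : irreflexive (@complete_rel n).
Proof. by move=> i; rewrite /complete_rel eqxx. Qed.

Definition complete n : sgraph := SGraph (@complete_sym n) (@complete_irrefl n).

Section Energies.
Local Open Scope ring_scope.

(* Eigenvalues and energies live in an arbitrary numClosedFieldType C, such as
   R[i] for R : realType, or algC; all the energies are nonnegative reals of C,
   so the order of C compares them as real numbers. *)
Variable C : numClosedFieldType.

(* The roots of the characteristic polynomial, listed with multiplicity;
   char_poly is monic, so that char_poly M = \prod_(z <- eigenvalues M)
   ('X - z%:P). *)
Definition eigenvalues n (M : 'M[C]_n) : seq C :=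
  sval (closed_field_poly_normal (char_poly M)).

Variable g : sgraph.

Definition adj_mx : 'M[C]_#|g| :=
  \matrix_(i, j) (adj (enum_val i) (enum_val j))%:R.

Definition deg_mx : 'M[C]_#|g| :=
  diag_mx (\row_i #|[set v | adj (enum_val i) v]|%:R).

Definition cn_mx : 'M[C]_#|g| :=
  \matrix_(i, j)
    if i == j then 0
    else #|[set w | [&& w != enum_val i, w != enum_val j,
                        adj (enum_val i) w & adj (enum_val j) w]]|%:R.

Definition avg_deg : C := 2 * #|edges g|%:R / #|g|%:R.

Definition energy : C := \sum_(z <- eigenvalues adj_mx) `|z|.

Definition cn_energy : C := \sum_(z <- eigenvalues cn_mx) `|z|.

Definition laplacian_energy : C :=
  \sum_(z <- eigenvalues (deg_mx - adj_mx)) `|z - avg_deg|.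

Definition signless_laplacian_energy : C :=
  \sum_(z <- eigenvalues (deg_mx + adj_mx)) `|z - avg_deg|.

End Energies.

Section Hyperenergetic.
Local Open Scope ring_scope.
Variables (C : numClosedFieldType) (g : sgraph).

Definition hypoenergetic : bool := energy C g < #|g|%:R.

Definition hyperenergetic : bool := energy C (complete #|g|) < energy C g.

Definition L_hyperenergetic : bool :=
  laplacian_energy C (complete #|g|) < laplacian_energy C g.

Definition Q_hyperenergetic : bool :=
  signless_laplacian_energy C (complete #|g|) < signless_laplacian_energy C g.

Definition CN_hyperenergetic : bool :=
  cn_energy C (complete #|g|) < cn_energy C g.

End Hyperenergetic.

Section SubgroupGenerating.
Local Open Scope group_scope.
Variables (gT : finGroupType) (G : {group gT}).

Definition subgroup_of := {H : {group gT} | H \subset G}.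

Definition sgb_vertex : finType := ((subg_of G * subg_of G) + subgroup_of)%type.

Definition generates (ab : subg_of G * subg_of G) (H : subgroup_of) : bool :=
  (val H : {set gT}) == <<[set sgval ab.1; sgval ab.2]>>.

Definition sgb_rel : rel sgb_vertex := fun u v =>
  match u, v with
  | inl ab, inr H | inr H, inl ab => generates ab H
  | _, _ => false
  end.

Lemma sgb_sym : symmetric sgb_rel.
Proof. by case=> ? [] ?. Qed.

Lemma sgb_irrefl : irreflexive sgb_rel.
Proof. by case. Qed.

Definition sgb_graph : sgraph := SGraph sgb_sym sgb_irrefl.

End SubgroupGenerating.

(* Main.v *)
Require Import Defs.
From mathcomp Require Import all_boot all_order all_algebra all_fingroup.
From mathcomp Require Import ring zify.

Set Implicit Arguments.
Unset Strict Implicit.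
Unset Printing Implicit Defensive.

Import Order.TTheory GRing.Theory Num.Theory.

(** Every pair of elements of a group G generates exactly one subgroup, so the
    subgroup generating graph of G is a forest of stars: each subgroup H is
    the centre of a star whose leaves are the k(H) pairs generating H. This is
    the only feature of the graph that the proof uses, and it makes all four
    spectra explicit. With N = |G|^2 leaves, s subgroups and average degree d,
    counting eigenvalues with multiplicity (N - s is a formal multiplicity,
    possibly negative):
    - adjacency: 0 (N - s times) and +- sqrt k(H) for every H;
    - Laplacian and signless Laplacian: 1 (N - s times), and 0 and k(H) + 1 for
      every H;
    - common neighbourhood: 0 (s times), -1 (N - s times) and k(H) - 1 for
      every H.
    These come from Sylvester's identity
      a^s det(a - B B') = a^N det(a - B' B)
    and a variant of it for block matrices, because the incidence matrix B of
    leaves against centres satisfies B^T B = diag(k(H)) ([incidence_gram]).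
    The same identity with the all-ones column yields the energies of the
    complete graphs.

    The inequalities are then elementary, since the k(H) sum to N.
    - 2 sqrt k(H) <= k(H) + 1, strictly unless k(H) = 1; summing over H, the
      energy is at most N + s, strictly if some star has two leaves. For a
      nontrivial group such a star exists: (x, 1) and (1, x) generate the same
      subgroup. Since N + s <= 2 (N + s - 1), the graph is not hyperenergetic.
    - |k(H) + 1 - d| <= |1 - d| + k(H), so both Laplacian energies are at most
      N |1 - d| + s d + N, and d (N + s) <= 2 N bounds this by 2 (N + s - 1).
    - |k(H) - 1| <= k(H) + 1 bounds the common neighbourhood energy by 2 N.
    So the conclusion holds for every nontrivial finite group
    ([sgb_graph_energies]); the dihedral presentation only serves to exclude
    the trivial group, through the quotient of order 2 that kills the
    rotation. *)

(** * Sylvester-type determinant identities *)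

Section SylvesterDeterminants.
Local Open Scope ring_scope.
Variables (R : comNzRingType) (n s : nat).

(** Right multiplication by the block matrix of rows (1, -B) and (0, a) makes
    the matrix block lower triangular. The factor [a ^+ s] is kept on the left
    because [a] need not be invertible; it will be a nonzero polynomial. *)
Lemma det_block_scalar (a : R) (B : 'M_(n, s)) (B' : 'M_(s, n)) (E : 'M_s) :
  a ^+ s * \det (block_mx a%:M B B' E) = a ^+ n * \det (a *: E - B' *m B).
Proof.
have <-: \det (block_mx 1%:M (- B) 0 a%:M) = a ^+ s.
  by rewrite det_ublock det1 mul1r det_scalar.
rewrite mulrC -det_mulmx mulmx_block !mulmx0 !mulmx1 !addr0.
rewrite mulmxN mul_scalar_mx mul_mx_scalar addNr mulmxN mul_mx_scalar.
by rewrite det_lblock det_scalar addrC.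
Qed.

(** Both sides are computed from the determinant of the block matrix of rows
    (a, B) and (B', 1), by eliminating either of its off-diagonal blocks. *)
Lemma det_scalar_sub_mulmx (a : R) (B : 'M_(n, s)) (B' : 'M_(s, n)) :
  a ^+ s * \det (a%:M - B *m B') = a ^+ n * \det (a%:M - B' *m B).
Proof.
have <-: \det (block_mx a%:M B B' 1%:M) = \det (a%:M - B *m B').
  have <-: \det (block_mx a%:M B B' 1%:M) * \det (block_mx 1%:M 0 (- B') 1%:M)
      = \det (block_mx a%:M B B' 1%:M).
    by rewrite det_lblock !det1 !mulr1.
  rewrite -det_mulmx mulmx_block !mulmx0 !mulmx1 !mul1mx !add0r mulmxN addrN.
  by rewrite det_ublock det1 mulr1.
by rewrite det_block_scalar scale_scalar_mx mulr1.
Qed.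

End SylvesterDeterminants.

(** * Sums over spectra *)

Section Spectra.
Local Open Scope ring_scope.
Variable C : numClosedFieldType.

Lemma char_poly_eigenvalues n (M : 'M[C]_n) :
  char_poly M = \prod_(z <- eigenvalues M) ('X - z%:P).
Proof.
rewrite /eigenvalues; case: closed_field_poly_normal => r /= {1}->.
by rewrite (monicP (char_poly_monic M)) scale1r.
Qed.

(** A simultaneous relabelling of rows and columns does not change the
    characteristic polynomial; this lets a graph on a sum type, enumerated
    arbitrarily, be studied through a block matrix. *)
Lemma char_poly_mxsub_bij n m (h : 'I_n -> 'I_m) (M : 'M[C]_m) :
  bijective h -> char_poly (mxsub h h M) = char_poly M.
Proof.
move=> bij_h; have e: n = m by have := bij_eq_card bij_h; rewrite !card_ord.
subst m; have inj_h := bij_inj bij_h; pose p := perm inj_h.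
have ->: mxsub h h M = row_perm p (col_perm p M).
  by apply/matrixP=> i j; rewrite !mxE !permE.
rewrite /char_poly.
have ->: char_poly_mx (row_perm p (col_perm p M))
    = row_perm p (col_perm p (char_poly_mx M)).
  by apply/matrixP=> i j; rewrite !mxE (inj_eq perm_inj).
rewrite row_permE col_permE !det_mulmx !det_perm odd_permV mulrC -mulrA.
by rewrite -signr_addb addbb mulr1.
Qed.

Lemma eigenvalues_mxsub_bij n m (h : 'I_n -> 'I_m) (M : 'M[C]_m) :
  bijective h -> eigenvalues (mxsub h h M) = eigenvalues M.
Proof. by move=> bij_h; rewrite /eigenvalues char_poly_mxsub_bij. Qed.

Variable f : C -> C.

(** Powers are left on both sides because the multiplicity l - k of a spectral
    value can be negative in the applications, where a = b: unique
    factorization identifies the two multisets of roots. *)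
Lemma sum_eigenvalues n (M : 'M[C]_n) a k b l (r : seq C) :
    ('X - a%:P) ^+ k * char_poly M
      = ('X - b%:P) ^+ l * \prod_(z <- r) ('X - z%:P) ->
  f a *+ k + \sum_(z <- eigenvalues M) f z = f b *+ l + \sum_(z <- r) f z.
Proof.
have XnE c i : ('X - c%:P) ^+ i = \prod_(z <- nseq i c) ('X - z%:P).
  by rewrite big_nseq iter_mulr_1.
have fnE c i : f c *+ i = \sum_(z <- nseq i c) f z.
  by rewrite big_nseq iter_addr_0.
rewrite char_poly_eigenvalues !XnE !fnE -!big_cat => /prod_XsubC_eq.
exact: perm_big.
Qed.

(** For each [j], the numbers [x j] and [y j] are the roots of
    (X - t) (X - e_j) - d_j, the factor contributed by the j-th column of [B];
    their sum and product are prescribed by Vieta's formulas. *)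
Lemma sum_eigenvalues_block n s (t : C) (B : 'M_(n, s)) (d e : 'rV_s)
    (x y : 'I_s -> C) :
    B^T *m B = diag_mx d ->
    (forall j, x j + y j = t + e 0 j) ->
    (forall j, x j * y j = t * e 0 j - d 0 j) ->
  f t *+ s + \sum_(z <- eigenvalues (block_mx t%:M B B^T (diag_mx e))) f z
    = f t *+ n + \sum_j (f (x j) + f (y j)).
Proof.
move=> BtB xDy xMy.
pose r := [seq x j | j : 'I_s] ++ [seq y j | j : 'I_s].
have ->: \sum_j (f (x j) + f (y j)) = \sum_(z <- r) f z.
  by rewrite big_cat !big_image big_split.
apply: sum_eigenvalues; rewrite /char_poly /char_poly_mx map_block_mx.
rewrite (scalar_mx_block n s) opp_block_mx add_block_mx !add0r.
have ->: 'X%:M - map_mx polyC t%:M = ('X - t%:P)%:M :> 'M_n.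
  by rewrite map_scalar_mx raddfB.
rewrite det_block_scalar mulmxN mulNmx opprK; congr (_ * _).
have ->: map_mx polyC B^T *m map_mx polyC B = diag_mx (map_mx polyC d).
  by rewrite -map_mxM BtB map_diag_mx.
have ->: ('X - t%:P) *: ('X%:M - map_mx polyC (diag_mx e))
      - diag_mx (map_mx polyC d)
    = diag_mx (\row_j (('X - (x j)%:P) * ('X - (y j)%:P))).
  apply/matrixP=> i j; rewrite !mxE; case: (i =P j) => [->|_]; last first.
    by rewrite !mulr0n polyC0 subrr mulr0 subr0.
  rewrite !mulr1n.
  transitivity ('X ^+ 2 - (x j + y j)%:P * 'X + (x j * y j)%:P).
    by rewrite xDy xMy !rmorphD !rmorphN !rmorphM /=; ring.
  by rewrite !rmorphD !rmorphM /=; ring.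
rewrite det_diag big_cat !big_image /= -big_split /=.
by apply: eq_bigr => j _; rewrite mxE.
Qed.

Lemma sum_eigenvalues_gram n s (t u : C) (B : 'M_(n, s)) (d : 'rV_s) :
    B^T *m B = diag_mx d ->
  f t *+ s + \sum_(z <- eigenvalues (t%:M + u *: (B *m B^T))) f z
    = f t *+ n + \sum_j f (t + u * d 0 j).
Proof.
move=> BtB; pose r := [seq t + u * d 0 j | j : 'I_s].
have ->: \sum_j f (t + u * d 0 j) = \sum_(z <- r) f z by rewrite big_image.
apply: sum_eigenvalues; rewrite /char_poly /char_poly_mx.
have ->: 'X%:M - map_mx polyC (t%:M + u *: (B *m B^T))
    = ('X - t%:P)%:M - map_mx polyC (u *: B) *m map_mx polyC B^T.
  rewrite -map_mxM -scalemxAl raddfD /= map_scalar_mx raddfB /=.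
  by rewrite opprD addrA.
rewrite det_scalar_sub_mulmx; congr (_ * _).
rewrite -map_mxM -scalemxAr BtB.
have ->: ('X - t%:P)%:M - map_mx polyC (u *: diag_mx d)
    = diag_mx (\row_j ('X - (t + u * d 0 j)%:P)).
  apply/matrixP=> i j; rewrite !mxE; case: (i =P j) => [->|_]; last first.
    by rewrite !mulr0n mulr0 polyC0 subr0.
  by rewrite !mulr1n rmorphD /= opprD addrA.
by rewrite det_diag big_image /=; apply: eq_bigr => j _; rewrite mxE.
Qed.

Lemma sum_eigenvalues_block_diag n s (A : 'M[C]_n) :
  \sum_(z <- eigenvalues (block_mx A 0 0 (0 : 'M_s))) f z
    = f 0 *+ s + \sum_(z <- eigenvalues A) f z.
Proof.
rewrite -[LHS]add0r -(mulr0n (f 0)); apply: sum_eigenvalues.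
rewrite expr0 mul1r -char_poly_eigenvalues /char_poly char_block_diag_mx.
by rewrite det_ublock mulrC /char_poly_mx map_mx0 !subr0 det_scalar.
Qed.

End Spectra.

(** * Energies of complete graphs *)

Section CompleteGraphs.
Local Open Scope ring_scope.
Variable C : numClosedFieldType.

(** The matrix is t I + u J, where J is the rank one product of the all-ones
    column and its transpose: its spectrum is t (m - 1 times) and t + u m.
    The term [f t] is added on the left so that m = 0 is covered too. *)
Lemma sum_eigenvalues_const (f : C -> C) (t u : C) m (M : 'M[C]_m) :
    (forall i j, M i j = t *+ (i == j) + u) ->
  f t + \sum_(z <- eigenvalues M) f z = f t *+ m + f (t + u * m%:R).
Proof.
move=> ME; pose B : 'M[C]_(m, 1) := const_mx 1.
have BtB : B^T *m B = diag_mx (const_mx m%:R).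
  apply/matrixP=> i j; rewrite !mxE !ord1 mulr1n.
  under eq_bigr do rewrite !mxE mulr1.
  by rewrite sumr_const card_ord.
have := sum_eigenvalues_gram f t u BtB.
rewrite mulr1n big_ord1 mxE => <-; have -> // : M = t%:M + u *: (B *m B^T).
by apply/matrixP=> i j; rewrite ME !mxE big_ord1 !mxE !mulr1.
Qed.

Variable n : nat.
Notation K := (complete n.+1).

Let card_K : #|K| = n.+1 :> nat.
Proof. exact: card_ord. Qed.

Lemma avg_deg_complete : avg_deg C K = n%:R.
Proof.
rewrite /avg_deg; have ->: edges K = [set A : {set 'I_n.+1} | #|A| == 2].
  apply/setP=> A; rewrite inE; apply/imset2P/cards2P => /=.
    by case=> u v _; rewrite inE /= => uv ->; exists u; exists v.
  by case=> u [v [uv ->]]; exists u v => //; rewrite inE.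
rewrite (card_draws _ 2) card_K.
rewrite -natrM -mul_bin_diag bin1 natrM mulrAC mulfV ?mul1r //.
by rewrite pnatr_eq0.
Qed.

Lemma deg_complete (v : K) : #|[set w | adj v w]| = n.
Proof.
transitivity #|predC1 v|; last by rewrite cardC1 card_K.
by apply: eq_card => w; rewrite !inE /= /complete_rel eq_sym.
Qed.

Lemma common_nbrs_complete (u v : K) : u != v ->
  #|[set w | [&& w != u, w != v, adj u w & adj v w]]| = n.-1.
Proof.
move=> uv; have n_gt0: (0 < n)%N by case: n u v uv => // u v; rewrite !ord1.
have c2: #|[set u; v]| = 2%N by rewrite cards2 uv.
apply: (@addnI #|[set u; v]|); transitivity #|K|; last first.
  by rewrite card_K c2 add2n prednK.
rewrite -(cardsC [set u; v]); congr (_ + _)%N; apply: eq_card => w.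
by rewrite !inE /= /complete_rel !(eq_sym _ w) negb_or; do 2!case: eqP.
Qed.

Lemma energy_complete : energy C K = 2 * n%:R.
Proof.
apply: (addrI `|- 1|); rewrite (sum_eigenvalues_const _ (t := - 1) (u := 1)).
  rewrite card_K.
  have ->: - 1 + 1 * n.+1%:R = n%:R :> C by ring.
  by rewrite normrN1 normr_nat; ring.
move=> i j; rewrite !mxE /= /complete_rel (inj_eq enum_val_inj).
by case: (i == j); rewrite ?addNr ?add0r.
Qed.

Lemma laplacian_energy_complete : laplacian_energy C K = 2 * n%:R.
Proof.
pose f z : C := `|z - n%:R|; rewrite /laplacian_energy avg_deg_complete.
apply: (addrI (f n.+1%:R)).
rewrite (sum_eigenvalues_const _ (t := n.+1%:R) (u := -1)).
  rewrite card_K mulN1r subrr /f.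
  have ->: n.+1%:R - n%:R = 1 :> C by ring.
  by rewrite sub0r normrN normr1 normr_nat; ring.
move=> i j; rewrite !mxE deg_complete /= /complete_rel (inj_eq enum_val_inj).
by case: (i == j); rewrite /=; ring.
Qed.

Lemma signless_laplacian_energy_complete :
  signless_laplacian_energy C K = 2 * n%:R.
Proof.
pose f z : C := `|z - n%:R|.
rewrite /signless_laplacian_energy avg_deg_complete.
apply: (addrI (f (n%:R - 1))).
rewrite (sum_eigenvalues_const _ (t := n%:R - 1) (u := 1)).
  rewrite card_K /f.
  have ->: n%:R - 1 + 1 * n.+1%:R - n%:R = n%:R :> C by ring.
  have ->: n%:R - 1 - n%:R = - 1 :> C by ring.
  by rewrite normrN1 normr_nat; ring.
move=> i j; rewrite !mxE deg_complete /= /complete_rel (inj_eq enum_val_inj).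
by case: (i == j); rewrite /=; ring.
Qed.

Lemma cn_energy_complete : cn_energy C K = 2 * n%:R * n.-1%:R.
Proof.
apply: (addrI `|- n.-1%:R|).
rewrite (sum_eigenvalues_const _ (t := - n.-1%:R) (u := n.-1%:R)).
  rewrite card_K.
  have ->: - n.-1%:R + n.-1%:R * n.+1%:R = (n.-1 * n)%:R :> C by ring.
  by rewrite normrN !normr_nat; ring.
move=> i j; rewrite !mxE; case: eqP => [_|/eqP ij]; first by rewrite addNr.
by rewrite common_nbrs_complete ?add0r // (inj_eq enum_val_inj).
Qed.

End CompleteGraphs.

(** * Spectra of star forests *)

Lemma sum_enum_val (V : nmodType) (T : finType) (F : T -> V) :
  (\sum_(i < #|T|) F (enum_val i) = \sum_x F x)%R.
Proof. by rewrite -(big_enum_val (A := T)). Qed.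

Section StarForests.
Local Open Scope ring_scope.
Variables (L R : finType) (c : L -> R).

(** The stars are the fibres of [c], which sends a leaf to its centre; a centre
    outside the image of [c] is an isolated vertex. *)
Definition star_rel : rel (L + R)%type := fun u v =>
  match u, v with
  | inl l, inr r | inr r, inl l => c l == r
  | _, _ => false
  end.

Definition leaves r := [set l | c l == r].

Lemma sum_card_leaves : (\sum_r #|leaves r| = #|L|)%N.
Proof.
rewrite -sum1_card (partition_big c predT) //=; apply: eq_bigr => r _.
by rewrite -sum1_card; apply: eq_bigl => l; rewrite inE.
Qed.

(* The relation is only assumed to agree pointwise with [star_rel], because the
   graph of a group comes with its own relation and its own proofs. *)
Variables (e : rel (L + R)%type) (e_sym : symmetric e) (e_irr : irreflexive e).
Hypothesis e_star : e =2 star_rel.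
Notation forest := (SGraph e_sym e_irr).

Lemma card_forest : #|forest| = (#|L| + #|R|)%N.
Proof. exact: card_sum. Qed.

Lemma card_edges_forest : (#|edges forest| <= #|L|)%N.
Proof.
pose edge l : {set forest} := [set inl l; inr (c l)].
rewrite (leq_trans _ (leq_imset_card edge L)) // subset_leq_card //.
apply/subsetP=> A /imset2P[u v _]; rewrite inE /= e_star.
case: u v => [l|r] [l'|r'] //= /eqP <- ->; apply/imsetP.
  by exists l.
by exists l' => //; rewrite setUC.
Qed.

Lemma deg_leaf l : #|[set v | adj (inl l : forest) v]| = 1%N.
Proof.
rewrite -(cards1 (inr (c l) : forest)); apply: eq_card => v.
by rewrite !inE /= e_star; case: v => [l'|r] //=; rewrite eq_sym.
Qed.

Lemma deg_centre r : #|[set v | adj (inr r : forest) v]| = #|leaves r|.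
Proof.
rewrite -(card_imset _ (@inl_inj L R)); apply: eq_card => -[l|r'].
  by rewrite mem_imset ?inE //= ?e_star; last exact: inl_inj.
by rewrite inE /= e_star; apply/esym/imsetP => -[].
Qed.

Lemma common_nbrs_forest (u v : forest) : u != v ->
  #|[set w | [&& w != u, w != v, adj u w & adj v w]]|
    = if (u, v) is (inl l, inl l') then c l == c l' else 0%N.
Proof.
case: u v => [l|r] [l'|r'] // uv.
- have [cll'|cNll'] := eqVneq (c l) (c l').
    transitivity #|[set (inr (c l) : forest)]|; last by rewrite cards1.
    apply: eq_card => -[w|w].
      by rewrite !inE /= !e_star /= !andbF.
    by rewrite !inE /= !e_star /= -cll' andbb eq_sym.
  apply: eq_card0 => -[w|w]; rewrite inE /= !e_star ?andbF //=.
  by case: eqP => // <-; rewrite eq_sym; apply: negbTE.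
- by apply: eq_card0 => -[w|w]; rewrite inE /= !e_star /= ?andbF.
- by apply: eq_card0 => -[w|w]; rewrite inE /= !e_star /= ?andbF.
apply: eq_card0 => -[w|w]; rewrite inE /= !e_star ?andbF //=.
by case: eqP => // ->; apply: contraNF uv => /eqP ->.
Qed.

Variable C : numClosedFieldType.

Definition forest_index (i : 'I_#|forest|) : 'I_(#|L| + #|R|) :=
  match enum_val i with
  | inl l => lshift _ (enum_rank l)
  | inr r => rshift _ (enum_rank r)
  end.

Lemma forest_index_bij : bijective forest_index.
Proof.
exists (fun k => enum_rank (match split k with
  | inl i => inl (enum_val i) | inr j => inr (enum_val j) end : forest)) => k.
  rewrite /forest_index -[RHS]enum_valK; congr enum_rank.
  case: (enum_val k) => x.
    by rewrite (unsplitK (inl _)) enum_rankK.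
  by rewrite (unsplitK (inr _)) enum_rankK.
rewrite /forest_index enum_rankK -[RHS]splitK.
by case: split => i /=; rewrite enum_valK.
Qed.

Definition incidence_mx : 'M[C]_(#|L|, #|R|) :=
  \matrix_(i, j) (c (enum_val i) == enum_val j)%:R.

Definition leaves_row : 'rV[C]_#|R| := \row_j #|leaves (enum_val j)|%:R.

Lemma incidence_gram : incidence_mx^T *m incidence_mx = diag_mx leaves_row.
Proof.
apply/matrixP=> i j; rewrite !mxE.
under eq_bigr do rewrite !mxE -natrM mulnb.
rewrite (sum_enum_val
  (fun l => ((c l == enum_val i) && (c l == enum_val j))%:R)).
rewrite -natr_sum /=; case: (i =P j) => [->|ij].
  rewrite mulr1n -sum1_card [in RHS]big_mkcond; congr _%:R.
  apply: eq_bigr => l _; by rewrite inE andbb; case: ifP.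
rewrite big1 // => l _; case: eqP => //= ->.
by rewrite (inj_eq enum_val_inj); case: eqP ij.
Qed.

Lemma incidence_cogram : incidence_mx *m incidence_mx^T
  = \matrix_(i, j) (c (enum_val i) == c (enum_val j))%:R.
Proof.
apply/matrixP=> i j; rewrite !mxE; under eq_bigr do rewrite !mxE -natrM mulnb.
rewrite (sum_enum_val
  (fun r => ((c (enum_val i) == r) && (c (enum_val j) == r))%:R)).
rewrite -natr_sum (bigD1 (c (enum_val i))) //= eqxx big1 ?addn0 => [|r].
  by rewrite eq_sym.
by rewrite eq_sym; case: eqP.
Qed.

Local Notation B := incidence_mx.
Local Notation deg r := (#|leaves r|%:R : C).

Lemma adj_mx_forest : adj_mx C forest
  = mxsub forest_index forest_index (block_mx 0%:M B B^T (diag_mx 0)).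
Proof.
apply/matrixP=> i j; rewrite raddf0 linear0 2!mxE /= e_star /forest_index.
case: (enum_val i) (enum_val j) => x [] y; rewrite /= ?block_mxEul ?block_mxEur
  ?block_mxEdl ?block_mxEdr !mxE ?enum_rankK //.
Qed.

Lemma deg_mx_forest : deg_mx C forest
  = mxsub forest_index forest_index (block_mx 1%:M 0 0 (diag_mx leaves_row)).
Proof.
apply/matrixP=> i j; rewrite 2!mxE [RHS]mxE; case: eqVneq => [->|ij].
  rewrite /forest_index; case: (enum_val j) => x; rewrite ?deg_leaf ?deg_centre.
    by rewrite block_mxEul mxE eqxx.
  by rewrite block_mxEdr !mxE eqxx enum_rankK.
rewrite /forest_index; have := ij; rewrite -(inj_eq enum_val_inj).
case: (enum_val i) (enum_val j) => x [] y xy; rewrite ?block_mxEul ?block_mxEur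
  ?block_mxEdl ?block_mxEdr !mxE // (inj_eq enum_rank_inj);
  by have /negbTE ->: x != y by apply: contra_neq xy => ->.
Qed.

Lemma cn_mx_forest : cn_mx C forest
  = mxsub forest_index forest_index
      (block_mx ((- 1)%:M + 1 *: (B *m B^T)) 0 0 0).
Proof.
rewrite incidence_cogram scale1r.
apply/matrixP=> i j; rewrite [LHS]mxE [RHS]mxE; case: eqVneq => [->|ij].
  rewrite /forest_index; case: (enum_val j) => x; last first.
    by rewrite block_mxEdr mxE.
  by rewrite block_mxEul !mxE !eqxx addNr.
rewrite common_nbrs_forest ?(inj_eq enum_val_inj) // /forest_index.
have := ij; rewrite -(inj_eq enum_val_inj).
case: (enum_val i) (enum_val j) => x [] y xy; rewrite ?block_mxEul ?block_mxEur
  ?block_mxEdl ?block_mxEdr; [|by rewrite mxE..].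
rewrite !mxE !enum_rankK (inj_eq enum_rank_inj).
have /negbTE ->: x != y by apply: contra_neq xy => ->.
by rewrite add0r.
Qed.

(** Taking u = -1 and u = 1 treats the Laplacian and the signless Laplacian at
    once; they have the same spectrum since only u^2 enters it. *)
Lemma deg_add_adj_mx_forest (u : C) : deg_mx C forest + u *: adj_mx C forest
  = mxsub forest_index forest_index
      (block_mx 1%:M (u *: B) (u *: B)^T (diag_mx leaves_row)).
Proof.
rewrite deg_mx_forest adj_mx_forest -linearZ -raddfD /= scale_block_mx.
rewrite add_block_mx !add0r linearZ /= raddf0 scaler0 addr0 raddf0 scaler0.
by rewrite addr0.
Qed.

Lemma sum_row_forest (F : C -> C) :
  \sum_j F (leaves_row 0 j) = \sum_r F (deg r).
Proof.
rewrite -(sum_enum_val (fun r => F (deg r))).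
by apply: eq_bigr => j _; rewrite mxE.
Qed.

Lemma energy_forest : energy C forest = \sum_r 2 * sqrtC (deg r).
Proof.
rewrite /energy -[LHS]add0r adj_mx_forest eigenvalues_mxsub_bij; last first.
  exact: forest_index_bij.
pose x j := sqrtC (leaves_row 0 j).
have := sum_eigenvalues_block Num.norm (t := 0) (e := 0) (x := x)
  (y := fun j => - x j) incidence_gram.
rewrite normr0 !mul0rn !add0r => ->; first last.
- by move=> j; rewrite mul0r sub0r mulrN -expr2 sqrtCK.
- by move=> j; rewrite addrN mxE addr0.
rewrite (sum_row_forest (fun z => `|sqrtC z| + `|- sqrtC z|)).
apply: eq_bigr => r _; rewrite normrN ger0_norm ?sqrtC_ge0 ?ler0n //.
by rewrite mulr2n mulrDl mul1r.
Qed.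

Lemma sum_eigenvalues_deg_add_adj (f : C -> C) (u : C) : u ^+ 2 = 1 ->
  f 1 *+ #|R|
      + \sum_(z <- eigenvalues (deg_mx C forest + u *: adj_mx C forest)) f z
    = f 1 *+ #|L| + \sum_r (f 0 + f (deg r + 1)).
Proof.
move=> u2; rewrite deg_add_adj_mx_forest eigenvalues_mxsub_bij; last first.
  exact: forest_index_bij.
have uBtuB : (u *: B)^T *m (u *: B) = diag_mx leaves_row.
  rewrite [(_ *: _)^T]linearZ /= -scalemxAl -scalemxAr scalerA -expr2 u2.
  rewrite scale1r; exact: incidence_gram.
rewrite (sum_eigenvalues_block f (x := fun=> 0)
  (y := fun j => leaves_row 0 j + 1) uBtuB) => [|j|j].
- by rewrite (sum_row_forest (fun z => f 0 + f (z + 1))).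
- by rewrite add0r addrC.
by rewrite mul0r mul1r subrr.
Qed.

Lemma laplacian_energy_forest (f := fun z => `|z - avg_deg C forest|) :
  f 1 *+ #|R| + laplacian_energy C forest
    = f 1 *+ #|L| + \sum_r (f 0 + f (deg r + 1)).
Proof.
have N1sq : (- 1) ^+ 2 = 1 :> C by rewrite sqrrN expr1n.
by have := sum_eigenvalues_deg_add_adj f N1sq; rewrite scaleN1r.
Qed.

Lemma signless_laplacian_energy_forest (f := fun z => `|z - avg_deg C forest|) :
  f 1 *+ #|R| + signless_laplacian_energy C forest
    = f 1 *+ #|L| + \sum_r (f 0 + f (deg r + 1)).
Proof.
by have := sum_eigenvalues_deg_add_adj f (expr1n C 2); rewrite scale1r.
Qed.

Lemma cn_energy_forest :
  #|R|%:R + cn_energy C forest = #|L|%:R + \sum_r `|deg r - 1|.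
Proof.
rewrite /cn_energy cn_mx_forest eigenvalues_mxsub_bij; last first.
  exact: forest_index_bij.
rewrite sum_eigenvalues_block_diag normr0 mul0rn add0r.
have := sum_eigenvalues_gram Num.norm (- 1) 1 incidence_gram.
rewrite normrN1 => ->; rewrite (sum_row_forest (fun z => `|- 1 + 1 * z|)).
by congr (_ + _); apply: eq_bigr => r _; rewrite mul1r addrC.
Qed.

End StarForests.

(** * Energy bounds for star forests *)

Section StarForestEnergies.
Local Open Scope ring_scope.
Variables (C : numClosedFieldType) (L R : finType) (c : L -> R).
Variables (e : rel (L + R)%type) (e_sym : symmetric e) (e_irr : irreflexive e).
Hypothesis e_star : e =2 star_rel c.
Variables l1 l2 : L.
Hypotheses (l1Nl2 : l1 != l2) (cl12 : c l1 = c l2).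
Notation forest := (SGraph e_sym e_irr).
Local Notation k r := #|leaves c r|.

Let sum_leavesE : \sum_r (k r)%:R = #|L|%:R :> C.
Proof. by rewrite -natr_sum sum_card_leaves. Qed.

Let card_leaves_gt1 : (1 < k (c l1))%N.
Proof.
have <- : #|[set l1; l2]| = 2%N by rewrite cards2 l1Nl2.
by apply/subset_leq_card/subsetP=> l; rewrite !inE => /orP[] /eqP ->;
  rewrite ?cl12.
Qed.

Let card_L_gt1 : (1 < #|L|)%N.
Proof. exact: leq_trans card_leaves_gt1 (max_card _). Qed.

Let card_R_gt0 : (0 < #|R|)%N.
Proof. by apply/card_gt0P; exists (c l1). Qed.

(** Sum of the inequalities 2 sqrt k <= k + 1 over all stars, each of them the
    expansion of (sqrt k - 1)^2 >= 0; it is strict at the star of [l1], which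
    has at least two leaves. *)
Lemma star_forest_hypoenergetic : hypoenergetic C forest.
Proof.
have amgm r : 2 * sqrtC (k r)%:R + (sqrtC (k r)%:R - 1) ^+ 2
    = (k r)%:R + 1 :> C.
  by rewrite -[X in _ = X + 1]sqrtCK; ring.
have real_sqrtB1 r : sqrtC (k r)%:R - 1 \is @Num.real C.
  by rewrite realB ?real1 // sqrtC_real ?ler0n.
rewrite /hypoenergetic (energy_forest _ _ e_star) card_forest natrD.
rewrite -sum_leavesE -[#|R|%:R]sumr_const -big_split /=.
rewrite (bigD1 (c l1)) // [ltRHS](bigD1 (c l1)) //= ltr_leD //.
  rewrite -amgm ltrDl real_exprn_even_gt0 //= subr_eq0.
  apply: contraTneq card_leaves_gt1 => /(congr1 (fun z => z ^+ 2)).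
  by rewrite sqrtCK expr1n => /eqP; rewrite pnatr_eq1 => /eqP ->.
by apply: ler_sum => r _; rewrite -amgm lerDl -realEsqr.
Qed.

Let avg := avg_deg C forest.

Let avg_ge0 : 0 <= avg.
Proof. by rewrite /avg /avg_deg divr_ge0 ?mulr_ge0 ?ler0n. Qed.

Let avg_le : avg * (#|L| + #|R|)%:R <= 2 * #|L|%:R.
Proof.
rewrite /avg /avg_deg card_forest mulfVK; last first.
  by rewrite pnatr_eq0 addn_eq0 negb_and -!lt0n card_R_gt0 orbT.
by rewrite -!natrM ler_nat leq_mul2l (card_edges_forest _ _ e_star).
Qed.

(** With N leaves, s centres and average degree d, the triangle inequality
    gives x <= N |1 - d| + s d + N. If d >= 1 this is d (N + s) <= 2 N; if
    d < 1, the defect N + s - 1 - N (1 - d) - s d is equal to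
    (1 - d) (s - 1) + d (N - 1) >= 0. *)
Lemma star_forest_laplacian_le x (f := fun z => `|z - avg|) :
    f 1 *+ #|R| + x = f 1 *+ #|L| + \sum_r (f 0 + f ((k r)%:R + 1)) ->
  x <= 2 * (#|L| + #|R|).-1%:R.
Proof.
move=> xE; have f0: f 0 = avg by rewrite /f sub0r normrN ger0_norm.
have far : \sum_r f ((k r)%:R + 1) <= f 1 *+ #|R| + #|L|%:R.
  rewrite -sum_leavesE -sumr_const -big_split; apply: ler_sum => r _ /=.
  by rewrite /f -addrA addrC (le_trans (ler_normD _ _)) // normr_nat.
have {xE far}: x <= f 1 *+ #|L| + avg *+ #|R| + #|L|%:R.
  rewrite -(lerD2l (f 1 *+ #|R|)) xE big_split /= f0 sumr_const.
  by rewrite [leLHS]addrA [leRHS]addrCA lerD2l.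
move/le_trans; apply.
have := (avg_le, card_L_gt1, card_R_gt0).
move: #|L| #|R| => N s [[avgNs N_gt1] s_gt0].
have [n nE] : exists n, (N + s = n.+1)%N.
  by exists (N + s).-1; rewrite prednK // addn_gt0 s_gt0 orbT.
have NE : n%:R + 1 = N%:R + s%:R :> C by rewrite -natrD nE mulrSr.
have N1 : 1 <= N%:R :> C by rewrite ler1n ltnW.
have s1 : 1 <= s%:R :> C by rewrite ler1n.
rewrite nE /= -[f 1 *+ N]mulr_natr -[avg *+ s]mulr_natr.
have Nn : N%:R <= n%:R :> C by rewrite ler_nat -ltnS -nE -addn1 leq_add2l.
have [avg1|avg1] := real_leP (ger0_real ler01) (ger0_real avg_ge0).
  rewrite /f -normrN opprB ger0_norm ?subr_ge0 //.
  have ->: (avg - 1) * N%:R + avg * s%:R + N%:R = avg * (N + s)%:R.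
    by rewrite natrD; ring.
  by rewrite (le_trans avgNs) // ler_pM2l ?ltr0n.
have avgle1 : 0 <= 1 - avg by rewrite subr_ge0 ltW.
rewrite /f (ger0_norm avgle1) [leRHS]mulr_natl [leRHS]mulr2n lerD //.
rewrite -(lerD2r 1) NE -subr_ge0.
have ->: N%:R + s%:R - ((1 - avg) * N%:R + avg * s%:R + 1)
  = (1 - avg) * (s%:R - 1) + avg * (N%:R - 1) by ring.
by rewrite addr_ge0 // mulr_ge0 ?subr_ge0 // ltW.
Qed.

Let card_forestE : #|forest| = (#|L| + #|R|).-1.+1 :> nat.
Proof. by rewrite card_forest prednK // addn_gt0 card_R_gt0 orbT. Qed.

Lemma star_forest_nonhyperenergetic : ~~ hyperenergetic C forest.
Proof.
rewrite /hyperenergetic le_gtF //.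
apply: le_trans (ltW star_forest_hypoenergetic) _.
rewrite card_forestE energy_complete -natrM ler_nat.
have: (0 < (#|L| + #|R|).-1)%N.
  by rewrite -ltnS prednK ?addn_gt0 ?card_R_gt0 ?orbT // ltn_addr.
lia.
Qed.

Lemma star_forest_nonLhyperenergetic : ~~ L_hyperenergetic C forest.
Proof.
rewrite /L_hyperenergetic le_gtF // card_forestE laplacian_energy_complete.
exact: star_forest_laplacian_le (laplacian_energy_forest _ _ e_star C).
Qed.

Lemma star_forest_nonQhyperenergetic : ~~ Q_hyperenergetic C forest.
Proof.
rewrite /Q_hyperenergetic le_gtF // card_forestE.
rewrite signless_laplacian_energy_complete.
exact: star_forest_laplacian_le (signless_laplacian_energy_forest _ _ e_star C).
Qed.

Lemma star_forest_nonCNhyperenergetic : ~~ CN_hyperenergetic C forest.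
Proof.
rewrite /CN_hyperenergetic le_gtF // card_forestE cn_energy_complete.
have: cn_energy C forest <= 2 * #|L|%:R.
  rewrite -(lerD2l #|R|%:R) (cn_energy_forest _ _ e_star).
  rewrite mulr2n mulrDl mul1r [leRHS]addrCA lerD2l -sum_leavesE -sumr_const.
  rewrite -big_split; apply: ler_sum => r _ /=.
  by rewrite (le_trans (ler_normB _ _)) // normr_nat normr1 addrC.
move/le_trans; apply; rewrite -!natrM ler_nat -mulnA leq_mul2l /=.
have := card_R_gt0; have := card_L_gt1; case: #|L| => [|[|n]] // _.
case: #|R| => // s _; rewrite addnS /= -[n.+2]muln1 leq_mul //; lia.
Qed.

End StarForestEnergies.

(** * The subgroup generating graph *)

Section NontrivialGroup.
Variables (C : numClosedFieldType) (gT : finGroupType) (G : {group gT}).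
Hypothesis G_neq1 : G :!=: 1%g.

Fact gen_pair_sub (ab : subg_of G * subg_of G) :
  (<<[set sgval ab.1; sgval ab.2]>> \subset G)%g.
Proof. by rewrite gen_subG subUset !sub1set !subgP. Qed.

Definition gen_pair (ab : subg_of G * subg_of G) : subgroup_of G :=
  exist _ <<[set sgval ab.1; sgval ab.2]>>%G (gen_pair_sub ab).

Lemma sgb_rel_star : @sgb_rel gT G =2 star_rel gen_pair.
Proof.
have gE ab H : generates ab H = (gen_pair ab == H).
  by rewrite -val_eqE eq_sym.
by case=> ? [] ? //=.
Qed.

(** The two distinct leaves of one star are (x, 1) and (1, x), for x <> 1. *)
Theorem sgb_graph_energies :
  [/\ hypoenergetic C (sgb_graph G),
      ~~ hyperenergetic C (sgb_graph G),
      ~~ L_hyperenergetic C (sgb_graph G),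
      ~~ Q_hyperenergetic C (sgb_graph G)
    & ~~ CN_hyperenergetic C (sgb_graph G)].
Proof.
have [x xG xN1] := trivgPn _ G_neq1.
pose y := subg G x.
have yN1 : ((y, 1%g) != (1%g, y) :> subg_of G * subg_of G).
  rewrite xpair_eqE negb_and -(inj_eq val_inj) /=.
  by rewrite subgK ?xN1.
have gy : gen_pair (y, 1%g) = gen_pair (1%g, y).
  by apply/val_inj/val_inj; rewrite /= setUC.
split.
- exact: star_forest_hypoenergetic sgb_rel_star _ _ yN1 gy.
- exact: star_forest_nonhyperenergetic sgb_rel_star _ _ yN1 gy.
- exact: star_forest_nonLhyperenergetic sgb_rel_star _ _ yN1 gy.
- exact: star_forest_nonQhyperenergetic sgb_rel_star _ _ yN1 gy.
- exact: star_forest_nonCNhyperenergetic sgb_rel_star _ _ yN1 gy.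
Qed.

End NontrivialGroup.

(** The cyclic group of order 2, with a sent to the identity and b to the
    generator, satisfies the relations of the presentation, so it is an image
    of [G]. *)
Lemma dihedral_neq1 p (gT : finGroupType) (G : {group gT}) :
  (G \isog Grp (a : b : a ^+ p = b ^+ 2 = 1, b * a * b = a^-1))%g ->
  G :!=: 1%g.
Proof.
move=> isoG; have homG: ([set: 'Z_2] \homg G)%g.
  rewrite isoG; apply/existsP; exists (1%g, Zp1 : 'Z_2).
  by rewrite /= !xpair_eqE /= cycle1 joing1G expg1n invg1 Zp_cycle !eqxx.
apply: contraTneq homG => ->; apply/negP => /card_homg.
by rewrite cards1 cardsT card_ord.
Qed.

Theorem theorem3p5 (C : numClosedFieldType) (p : nat) (gT : finGroupType)
    (G : {group gT}) :
  prime p ->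
  (G \isog Grp (a : b : a ^+ p = b ^+ 2 = 1, b * a * b = a^-1))%g ->
  [/\ hypoenergetic C (sgb_graph G),
      ~~ hyperenergetic C (sgb_graph G),
      ~~ L_hyperenergetic C (sgb_graph G),
      ~~ Q_hyperenergetic C (sgb_graph G)
    & ~~ CN_hyperenergetic C (sgb_graph G)].
Proof. by move=> _ /dihedral_neq1; apply: sgb_graph_energies. Qed.
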